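(* Let $n,a,b\in\mathbb{N}$ with $b\geq a$ be such that $\sum_{i=1}^n i=\sum_{i=a}^b i$. Then for every integer $t$ with $a\leq t\leq b$ there exists a subset $U_t\subseteq [n]$ such that $U_i\cap U_j=\emptyset$ for all $i\neq j$ (with $a\leq i,j\leq b$), $[n]=\bigcup_{a\leq t\leq b}U_t$, and $\sum_{i\in U_t}i=t$ for every $a\leq t\leq b$.
   Context: $\mathbb{N}$ denotes the set of natural numbers without $0$, and $[n]$ denotes the set of numbers $1,2,3,\ldots,n$. *)

(* Defs.v *)
From mathcomp Require Import all_boot.

Set Implicit Arguments.
Unset Strict Implicit.
Unset Printing Implicit Defensive.

(* [n] = {1, ..., n} inside 'I_n.+1 = {0, ..., n}, so that the natural number
   underlying an element is the element itself, with no shift by one. *)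
Definition segment (n : nat) : {set 'I_n.+1} := [set i : 'I_n.+1 | 0 < i].

(* Main.v *)
(* Strong induction on [n], for the targets [a, ..., a + k - 1].  If [a <= n],
   each [t] in [a, n] is taken as a singleton, and [1, ..., a - 1] has to be
   split into the targets [n + 1, ..., a + k - 1].  If [n < a], then
   [2 * k <= n]; put [l = n - 2 * k] and form [k] pairs from the top [2 * k]
   elements, whose average pair sum is [M = 2 * l + 2 * k + 1].
   If [M < a], all pairs have sum [M], and [1, ..., l] is split into the targets
   [a - M, ..., a - M + k - 1].  If [a = M - p], the middle [2 * p + 1] pairs
   are rearranged so as to have the sums [M - p, ..., M + p], while the outer
   ones keep the sum [M] and are completed by splitting [1, ..., l] into the
   targets [p + 1, p + 2, ..., k - p - 1]. *)
Require Import Defs.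
From mathcomp Require Import all_boot zify.

Set Implicit Arguments.
Unset Strict Implicit.
Unset Printing Implicit Defensive.

(** By [permP] a permutation of sequences is an identity between counts; with each count abstracted
    to an arbitrary number, linear arithmetic decides it. *)
Ltac lia_count :=
  rewrite ?count_cat /=;
  repeat match goal with
    | |- context [count ?P ?s] => move: (count P s) => ?
    | |- context [nat_of_bool ?b] => move: (nat_of_bool b) => ?
  end; lia.

(** Working up to permutation lets blocks be built in any order, and multiplicities allow pairs with
    equal sums. *)
Definition splits (B : seq (seq nat)) (s m : seq nat) :=
  perm_eq (flatten B) s && perm_eq (map sumn B) m.

Lemma splits_perm B s1 s2 m1 m2 :
  perm_eq s1 s2 -> perm_eq m1 m2 -> splits B s1 m1 -> splits B s2 m2.
Proof.
move=> s12 m12 /andP[Bs Bm].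
by rewrite /splits (perm_trans Bs s12) (perm_trans Bm m12).
Qed.

Lemma splits_cat B1 B2 s1 s2 m1 m2 :
  splits B1 s1 m1 -> splits B2 s2 m2 -> splits (B1 ++ B2) (s1 ++ s2) (m1 ++ m2).
Proof.
move=> /andP[s1B m1B] /andP[s2B m2B].
by rewrite /splits flatten_cat map_cat !perm_cat.
Qed.

Lemma splits_singletons s : splits [seq [:: x] | x <- s] s s.
Proof.
rewrite /splits flatten_seq1 -map_comp.
by rewrite (eq_map (g := id)) ?map_id ?perm_refl // => x /=; rewrite addn0.
Qed.

Lemma iotaSr m n : iota m n.+1 = rcons (iota m n) (m + n).
Proof. by rewrite -addn1 iotaD cats1. Qed.

Lemma splits_rising_pairs x y z :
  splits [seq [:: x + r; y + r] | r <- iota 0 z]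
         (iota x z ++ iota y z) [seq x + y + r.*2 | r <- iota 0 z].
Proof.
apply/andP; split; last first.
  rewrite -map_comp (eq_map (g := fun r => x + y + r.*2)) ?perm_refl // => r /=.
  lia.
elim: z => [|z IHz] //.
rewrite !iotaSr map_rcons -!cats1 flatten_cat add0n.
by apply/permP => P; move: (permP IHz P); lia_count.
Qed.

(** The smallest element of the first run goes with the largest of the second, and so on inwards. *)
Lemma constant_pairs x y z :
  exists B, splits B (iota x z ++ iota y z) (nseq z (x + y + z.-1)).
Proof.
elim: z x => [|z IHz] x; first by exists [::].
have [B /andP[BsP BmP]] := IHz x.+1.
exists ([:: x; y + z] :: B); apply/andP; split.
  rewrite (iotaSr y) -cats1.
  by apply/permP => P; move: (permP BsP P); lia_count.
(* The two constants agree only for positive [z]; for [z = 0] the tail is empty. *)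
have -> : nseq z.+1 (x + y + z) = (x + (y + z + 0)) :: nseq z (x.+1 + y + z.-1).
  by case: z {IHz BsP BmP} => [|z] /=; congr (_ :: _); try congr (_ :: nseq _ _); lia.
by rewrite /= perm_cons.
Qed.

Lemma perm_interleave c p :
  perm_eq ([seq c + r.*2 | r <- iota 0 p.+1] ++ [seq c.+1 + r.*2 | r <- iota 0 p])
          (iota c p.*2.+1).
Proof.
elim: p => [|p]; first by rewrite /= addn0.
rewrite (iotaSr 0 p.+1) doubleS (iotaSr c p.*2.+2) (iotaSr c p.*2.+1) map_rcons.
set s := [seq c + r.*2 | r <- iota 0 p.+1] => IHp.
rewrite (iotaSr 0 p) map_rcons !add0n -!cats1 addSnnS -doubleS.
by apply/permP => P; move: (permP IHp P); lia_count.
Qed.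

(** Cut the run into blocks of lengths [p + 1], [p], [p], [p + 1]. Adding the first to the fourth
    and the second to the third, in increasing order, gives two progressions of step 2 that
    interleave. *)
Lemma consecutive_pairs u p :
  exists B, splits B (iota u (4 * p + 2)) (iota (2 * u + 3 * p + 1) p.*2.+1).
Proof.
have := splits_cat (splits_rising_pairs u (u + 3 * p + 1) p.+1)
                   (splits_rising_pairs (u + p.+1) (u + 2 * p + 1) p).
set B := (B in splits B) => HB; exists B; apply: splits_perm HB.
  have -> : 4 * p + 2 = p.+1 + (p + (p + p.+1)) by lia.
  rewrite !iotaD.
  have -> : u + p.+1 + p = u + 2 * p + 1 by lia.
  have -> : u + 2 * p + 1 + p = u + 3 * p + 1 by lia.
  by apply/permP => P; lia_count.
have <- : u + (u + 3 * p + 1) = 2 * u + 3 * p + 1 by lia.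
have -> : u + p.+1 + (u + 2 * p + 1) = (u + (u + 3 * p + 1)).+1 by lia.
exact: perm_interleave.
Qed.

(** Sums are known only up to order, but since those of [B2] are all [M], any matching of the blocks
    works. *)
Lemma splits_zip_constant B1 B2 s1 s2 a k M :
  splits B1 s1 (iota a k) -> splits B2 s2 (nseq k M) ->
  splits [seq x.1 ++ x.2 | x <- zip B1 B2] (s1 ++ s2) (iota (M + a) k).
Proof.
move=> /andP[s1B m1B] /andP[s2B m2B].
have sz1 : size B1 = k by rewrite -(size_map sumn) (perm_size m1B) size_iota.
have sz2 : size B2 = k by rewrite -(size_map sumn) (perm_size m2B) size_nseq.
have allM : all (pred1 M) (map sumn B2).
  by rewrite (perm_all _ m2B) all_nseq /= eqxx orbT.
have {sz1 sz2} : size B2 = size B1 by rewrite sz1.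
rewrite iotaDl => sz.
apply: (@splits_perm _ (flatten B1 ++ flatten B2) _ [seq M + x | x <- map sumn B1]).
- by rewrite perm_cat.
- exact: perm_map.
elim: B1 B2 allM sz {s1B m1B s2B m2B} => [|b1 B1 IHB] [|b2 B2] //=.
move=> /andP[/eqP b2M B2M] [sz].
have /andP[IHs IHm] := IHB _ B2M sz.
rewrite /splits /= sumn_cat b2M addnC perm_cons IHm andbT.
by apply/permP => P; move: (permP IHs P); lia_count.
Qed.

(* [h] is the equality of sums, doubled and freed of subtraction. *)
Lemma splits_iota n a k (a_gt0 : 0 < a) (h : n * n + n + k = 2 * a * k + k * k) :
  exists B, splits B (iota 1 n) (iota a k).
Proof.
elim/ltn_ind: n a k a_gt0 h => n IHn a k a_gt0 h.
have [n0|n_gt0] := posnP n.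
  have k0 : k = 0 by move: h; rewrite n0; nia.
  by exists [::]; rewrite n0 k0.
have [le_an|lt_na] := leqP a n.
  (* Otherwise the targets would be distinct elements of [1, n - 1], with too small a sum. *)
  have nak : n < a + k by nia.
  have [|||B HB] := IHn a.-1 _ n.+1 (a + k - n.+1); rewrite //; try nia.
  exists ([seq [:: x] | x <- iota a (n.+1 - a)] ++ B).
  apply: splits_perm (splits_cat (splits_singletons _) HB).
    have -> : iota 1 n = iota 1 (a.-1 + (n.+1 - a)) by congr iota; lia.
    by rewrite iotaD add1n prednK // perm_catC.
  have -> : iota a k = iota a (n.+1 - a + (a + k - n.+1)) by congr iota; lia.
  by rewrite iotaD (_ : a + (n.+1 - a) = n.+1) ?perm_refl //; lia.
have k_gt0 : 0 < k by nia.
(* All [k] targets are at least [n + 1], so n(n + 1) is at least 2k(n + 1). *)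
have le_2kn : 2 * k <= n by nia.
have [l nE] : exists l, n = l + 2 * k by exists (n - 2 * k); lia.
have [lt_Ma|le_aM] := ltnP (2 * l + 2 * k + 1) a.
  have [|||B HB] := IHn l _ (a - (2 * l + 2 * k + 1)) k; try nia.
  have [P HP] := constant_pairs l.+1 (l.+1 + k) k.
  rewrite (_ : l.+1 + _ + _ = 2 * l + 2 * k + 1) in HP; last lia.
  exists [seq x.1 ++ x.2 | x <- zip B P].
  apply: splits_perm (splits_zip_constant HB HP).
    by rewrite nE mul2n -addnn !iotaD add1n.
  by rewrite subnKC // ltnW.
have [p aE] : exists p, a + p = 2 * l + 2 * k + 1.
  by exists (2 * l + 2 * k + 1 - a); lia.
(* Substituting [n] and [a] turns [h] into l(l + 1) = k(k - 2p - 1), so [k] is at least [2 * p + 1];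
   [z] is the number of outer pairs. *)
have [z kE] : exists z, k = p.*2.+1 + z.
  by exists (k - p.*2.+1); nia.
have [|||B HB] := IHn l _ p.+1 z; try nia.
have [P HP] := constant_pairs l.+1 (l.+1 + z + (4 * p + 2)) z.
have [C HC] := consecutive_pairs (l.+1 + z) p.
exists (C ++ [seq x.1 ++ x.2 | x <- zip B P]).
apply: splits_perm (splits_cat HC (splits_zip_constant HB HP)).
  have -> : n = l + (z + (4 * p + 2 + z)) by lia.
  by rewrite !iotaD add1n; apply/permP => Q; lia_count.
rewrite kE iotaD; have -> : 2 * (l.+1 + z) + 3 * p + 1 = a by lia.
(* For [z = 0] the truncated [z.-1] makes the constant differ from M, but there are no outer
   pairs. *)
case: z {IHn h nE HB HP HC} kE => [|z] kE; first by rewrite !cats0.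
suff -> : l.+1 + (l.+1 + z.+1 + (4 * p + 2)) + z.+1.-1 + p.+1 = a + p.*2.+1 by [].
lia.
Qed.

Lemma sum_iota a k : 2 * (\sum_(a <= i < a + k) i) + k = 2 * a * k + k * k.
Proof.
elim: k => [|k IHk]; first by rewrite !addn0 big_geq ?muln0.
rewrite (addnS a k) big_nat_recr ?leq_addr //=. nia.
Qed.

Lemma mem_nth_flatten (T : eqType) (B : seq (seq T)) i x :
  x \in nth [::] B i -> x \in flatten B.
Proof.
move=> xi; apply/flattenP; exists (nth [::] B i) => //; apply: mem_nth.
by case: ltnP xi => // ?; rewrite nth_default.
Qed.

Lemma uniq_flatten_nth_inj (T : eqType) (B : seq (seq T)) i j x :
  uniq (flatten B) -> x \in nth [::] B i -> x \in nth [::] B j -> i = j.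
Proof.
elim: B i j => [|b B IHB] i j /=; first by rewrite !nth_nil.
rewrite cat_uniq => /and3P[_ /hasPn bB uB].
have notb k : x \in nth [::] B k -> x \notin b by move/mem_nth_flatten/bB.
case: i j => [|i] [|j] //= xi xj.
- by have := notb _ xj; rewrite xi.
- by have := notb _ xi; rewrite xj.
by rewrite (IHB _ _ uB xi xj).
Qed.

Lemma uniq_flatten_nth (T : eqType) (B : seq (seq T)) i :
  uniq (flatten B) -> uniq (nth [::] B i).
Proof.
elim: B i => [|b B IHB] [|i] //=; rewrite cat_uniq => /and3P[ub _ uB] //.
exact: IHB.
Qed.

Lemma sum_ord_mem_seq n (s : seq nat) :
  uniq s -> {in s, forall i, i <= n} -> \sum_(i < n.+1 | (i : nat) \in s) i = sumn s.
Proof.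
move=> us sn; rewrite sumnE.
rewrite -(big_mkord (fun i => i \in s) id) -big_filter; apply: perm_big.
apply: uniq_perm => // [|i]; first by rewrite filter_uniq ?iota_uniq.
rewrite mem_filter mem_index_iota /=.
by case: (boolP (i \in s)) => //= /sn; rewrite ltnS.
Qed.

Theorem theorem1 (n a b : nat) (n_gt0 : 0 < n) (a_gt0 : 0 < a) (b_gt0 : 0 < b)
  (le_ab : a <= b)
  (eq_sum : \sum_(1 <= i < n.+1) i = \sum_(a <= i < b.+1) i) :
  exists U : nat -> {set 'I_n.+1},
    [/\ forall t : nat, a <= t <= b -> U t \subset segment n,
        forall i j : nat, a <= i <= b -> a <= j <= b -> i <> j ->
          U i :&: U j = set0,
        segment n = \bigcup_(a <= t < b.+1) U t
      & forall t : nat, a <= t <= b -> \sum_(i in U t) (i : nat) = t].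
Proof.
have [k bE] : exists k, b.+1 = a + k by exists (b.+1 - a); lia.
have [B /andP[Bs Bm]] : exists B, splits B (iota 1 n) (iota a k).
  apply: splits_iota => //.
  have := sum_iota a k; have := sum_iota 1 n; rewrite -bE add1n eq_sum; lia.
have uB : uniq (flatten B) by rewrite (perm_uniq Bs) iota_uniq.
have um : uniq (map sumn B) by rewrite (perm_uniq Bm) iota_uniq.
have memB i : (i \in flatten B) = (0 < i <= n).
  by rewrite (perm_mem Bs) mem_iota add1n ltnS.
have memm t : (t \in map sumn B) = (a <= t <= b).
  by rewrite (perm_mem Bm) mem_iota -bE ltnS.
(* The block with sum [t]; if [t] is not a target, the index is out of range and the default gives
   the empty block. *)
pose blk t := nth [::] B (index t (map sumn B)).
have blkP t i : i \in blk t -> 0 < i <= n.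
  by move=> /mem_nth_flatten; rewrite memB.
exists (fun t => [set i : 'I_n.+1 | (i : nat) \in blk t]); split.
- move=> t tab; apply/subsetP => i; rewrite !inE => /blkP.
  by case/andP.
- move=> i j iab jab ij; apply/setP => x; rewrite !inE; apply/negbTE/andP.
  case=> xi xj; apply: ij.
  have := uniq_flatten_nth_inj uB xi xj => /(congr1 (nth 0 (map sumn B))).
  by rewrite !nth_index ?memm.
- apply/setP => i; rewrite inE; apply/idP/idP => [i_gt0|].
    have : (i : nat) \in flatten B by rewrite memB i_gt0 -ltnS ltn_ord.
    case/flattenP => c cB ic.
    have : sumn c \in map sumn B by rewrite map_f.
    rewrite memm => cab.
    rewrite (bigD1_seq (sumn c)) ?iota_uniq ?mem_index_iota ?ltnS //=.
    rewrite inE; apply/orP; left; rewrite inE /blk.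
    (* The block sums are distinct, so looking up the sum of [c] returns [c] itself. *)
    case/(nthP [::]): cB => j jB <- in ic *.
    rewrite -(nth_map [::] 0 sumn) // index_uniq ?size_map //.
  rewrite big_seq_cond; elim/big_ind: _ => [|X Y HX HY|t].
  - by rewrite inE.
  - by rewrite inE => /orP[/HX|/HY].
  rewrite mem_index_iota ltnS andbT inE => tab /blkP.
  by case/andP.
move=> t tab; rewrite -[RHS](_ : sumn (blk t) = t); last first.
  have tB : t \in map sumn B by rewrite memm.
  rewrite /blk -(nth_map [::] 0 sumn) ?nth_index //.
  by rewrite -index_mem size_map in tB.
rewrite -(@sum_ord_mem_seq n); first by apply: eq_bigl => i; rewrite inE.
  exact: uniq_flatten_nth.
by move=> i /blkP /andP[].
Qed.
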